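(* Let $(X,T)$ be a t.d.s. and let $(Y,\sigma)$ be the system constructed from $(X,T)$ as described in the context. Then for any $x,y\in Y$, the pair $(x,y)$ is both positively and negatively proximal for $\sigma$.
   Context: A t.d.s. $(X,T)$ is a compact metric space $X$ with metric $d_X$ together with a homeomorphism $T:X\to X$. A pair $(x,y)$ is positively proximal for $T$ if $\liminf_{n\to+\infty}d_X(T^nx,T^ny)=0$, and negatively proximal for $T$ if it is positively proximal for $T^{-1}$. Construction of $(Y,\sigma)$ from a t.d.s. $(X,T)$. Let $X_*=X\cup\{*\}$ with $*\notin X$ an added isolated point: $d_{X_*}$ extends $d_X$ with $d_{X_*}(x,* )=\mathrm{diam}(X)+1$ for $x\in X$; let $T_*:X_*\to X_*$ be $T$ on $X$ and $T_*( * )=*$. Let $X_*^{\mathbb Z}$ have the product topology (and a compatible metric) and let $\sigma((x_i)_i)=(x_{i+1})_i$. Fix a decreasing sequence $(\epsilon_k)_{k\ge0}$ with $0<\epsilon_k<1/2$. Fix integers $n_0<n_1<n_2<\cdots$ and, for each $k\ge 0$, a disjoint union $\{0,1,\dots,n_k-1\}=A_k\cup B_k$ with $0,n_k-1\in B_k$ such that: (i) $2\le\#A_k<n_k\epsilon_k$; (ii) for every integer $0\le i<n_k$ there is $a\in A_k$ with $a+i\in A_k\cup(n_k+A_k)$; (iii) for every integer $0<i\le \frac{n_k}{2}+1$, $\#((A_k+i)\cap B_k)\ge\sqrt{n_k/2}-1$ (such choices exist). Put $p_{-1}=1$, $p_k=n_kp_{k-1}$, $b_k=\#B_k$, and let $\tau_k:B_k\to\{0,1,\dots,b_k-1\}$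 be the strictly increasing bijection. Define $f_k:B_k\to(-(b_k-2),0]\cap\mathbb Z$ by $f_k(0)=0$, $f_k(n_k-1)=-(b_k-3)$, and $f_k(i)=\tau_k(i)-(b_k-2)$ otherwise. Put $b'_{-1}=1$ and $b'_k=b'_{k-1}\cdot\#f_k(B_k)=b'_{k-1}(b_k-2)$ for $k\ge0$. Define $g_k:B_k\times X_*\to X_*$ by $g_k(i,x)=T_*^{\,b'_{k-1}f_k(i)}x$. Let $Q_k=\{x\in X_*^{\mathbb Z}: x_{ip_{k-1}}=g_k(i,x_0)\ \forall i\in B_k\}$ and $P_k=\{x\in X_*^{\mathbb Z}: x_{ip_{k-1}}=*\ \forall i\in A_k\}$. Let $Y_{-1}=X_*^{\mathbb Z}$, $Y_k=Y_{k-1}\cap\bigcap_{n\in\mathbb Z}\sigma^{np_k}(P_k\cap Q_k)$ for $k\ge0$, and $Y=\bigcap_{k=0}^\infty\bigcup_{r=0}^{p_k-1}\sigma^{-r}Y_k$. $Y$ is closed and $\sigma$-invariant, and $(Y,\sigma)$ denotes the corresponding subsystem of $(X_*^{\mathbb Z},\sigma)$. *)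

(* Defs.v *)
From HB Require Import structures.
From mathcomp Require Import all_boot all_order all_algebra finmap.
From mathcomp Require Import all_classical all_reals all_analysis.

Set Implicit Arguments.
Unset Strict Implicit.
Unset Printing Implicit Defensive.

Import Order.TTheory GRing.Theory Num.Theory.
Import numFieldNormedType.Exports.

Local Open Scope classical_set_scope.
Local Open Scope ring_scope.

Record homeo (Z : topologicalType) := Homeo {
  homeo_fun :> Z -> Z;
  homeo_inv : Z -> Z;
  homeo_funK : cancel homeo_fun homeo_inv;
  homeo_invK : cancel homeo_inv homeo_fun;
  homeo_fun_continuous : continuous homeo_fun;
  homeo_inv_continuous : continuous homeo_inv }.

Definition inverse_homeo (Z : topologicalType) (h : homeo Z) : homeo Z :=
  Homeo (homeo_invK h) (homeo_funK h)
    (homeo_inv_continuous (h := h)) (homeo_fun_continuous (h := h)).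

Definition homeo_pow (Z : topologicalType) (h : homeo Z) (m : int) : Z -> Z :=
  match m with
  | Posz n => iter n h
  | Negz n => iter n.+1 (homeo_inv h)
  end.

Record tds (R : realType) := Tds {
  tds_space :> metricType R;
  tds_compact : compact [set: tds_space];
  tds_map : homeo tds_space }.

Definition compatible_metric (R : realType) (Z : topologicalType)
    (d : Z -> Z -> R) : Prop :=
  [/\ forall x y, d x y = 0 <-> x = y,
      forall x y, d x y = d y x,
      forall x y z, d x z <= d x y + d y z &
      forall x, nbhs x = filter_from [set e : R | 0 < e]
                                     (fun e => [set y | d x y < e])].

Definition positively_proximal (R : realType) (Z : topologicalType)
    (d : Z -> Z -> R) (h : homeo Z) (x y : Z) : Prop :=
  limn_einf (fun n => (d (iter n h x) (iter n h y))%:E) = 0%E.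

Definition negatively_proximal (R : realType) (Z : topologicalType)
    (d : Z -> Z -> R) (h : homeo Z) (x y : Z) : Prop :=
  positively_proximal d (inverse_homeo h) x y.

Definition diam (R : realType) (X : metricType R) : R :=
  sup [set mdist p.1 p.2 | p in [set: X * X]].

Lemma metric_continuousP (R : realType) (V W : metricType R) (h : V -> W) :
  continuous h <-> forall x (e : R), 0 < e -> exists2 d : R, 0 < d &
    forall y, mdist x y < d -> mdist (h x) (h y) < e.
Proof.
split=> [ch x e e0|ch x].
  have /metricType_numDomainType.cvgrPdist_lt/(_ e e0) := ch x.
  by move=> /metricType_numDomainType.nbhs_mdistP[d /= d0 xd]; exists d.
apply/metricType_numDomainType.cvgrPdist_lt => e /(ch x)[d d0 xd].
by apply/metricType_numDomainType.nbhs_mdistP; exists d.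
Qed.

Section adjoin_point.
Context {R : realType} (S : tds R).

Lemma le_diam (x y : S) : mdist x y <= diam S.
Proof.
apply: ub_le_sup; last by exists (x, y).
have bnd : \forall M \near +oo, [set: S] `<=` [set z | mdist x z <= M].
  apply: (iffLR (compact_near_coveringP _) (@tds_compact _ S)) => z _.
  near=> u M => /=.
  apply: (@le_trans _ _ (mdist x z + mdist z u)); first exact: metric_triangle.
  apply: (@le_trans _ _ (mdist x z + 1)).
    rewrite lerD2l; apply/ltW; near: u.
    have := @nbhsx_ballx _ S z 1 ltr01; apply: filterS => t.
    by rewrite ballEmdist.
  near: M; apply: nbhs_pinfty_ge; exact: num_real.
have [M HM] := filter_ex bnd.
exists (M + M) => _ [[a b] _ <-] /=.
apply: (le_trans (metric_triangle a x b)); apply: lerD; last exact: HM.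
by rewrite metric_sym; exact: HM.
Unshelve. all: by end_near. Qed.

(* The point * is None. *)
Definition adjoin : Type := option S.

HB.instance Definition _ := Choice.on adjoin.

Definition adjoin_dist (u v : adjoin) : R :=
  match u, v with
  | Some x, Some y => mdist x y
  | None, None => 0
  | _, _ => diam S + 1
  end.

Let diam1_gt0 (x : S) : 0 < diam S + 1.
Proof. by rewrite ltr_wpDl// (le_trans _ (le_diam x x))// mdist_ge0. Qed.

Let diam1_ge1 (x : S) : (diam S + 1 < 1) = false.
Proof.
by apply/negbTE; rewrite -leNgt lerDr (le_trans _ (le_diam x x))// mdist_ge0.
Qed.

Lemma adjoin_distxx u : adjoin_dist u u = 0.
Proof. by case: u => //= x; exact: mdistxx. Qed.

Lemma adjoin_dist_positivity u v : adjoin_dist u v = 0 -> u = v.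
Proof.
case: u v => [x|] [y|] //=; first by move=> /mdist_positivity ->.
- by move=> h; have := diam1_gt0 x; rewrite h ltxx.
- by move=> h; have := diam1_gt0 y; rewrite h ltxx.
Qed.

Lemma adjoin_dist_sym u v : adjoin_dist u v = adjoin_dist v u.
Proof. by case: u v => [x|] [y|] //=; exact: metric_sym. Qed.

Lemma adjoin_dist_triangle v u w :
  adjoin_dist u w <= adjoin_dist u v + adjoin_dist v w.
Proof.
case: u v w => [x|] [y|] [z|] //=.
- exact: metric_triangle.
- by rewrite lerDr mdist_ge0.
- apply: (le_trans (le_diam x z)); apply: (@le_trans _ _ (diam S + 1)).
    by rewrite lerDl.
  by rewrite lerDl ltW// (diam1_gt0 x).
- by rewrite addr0.
- by rewrite lerDl mdist_ge0.
- by rewrite addr_ge0// ltW// (diam1_gt0 y).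
- by rewrite add0r.
Qed.

HB.instance Definition _ := @isMetric.Build R adjoin adjoin_dist
  adjoin_distxx adjoin_dist_positivity adjoin_dist_sym adjoin_dist_triangle.

Let omap_continuous (h : S -> S) :
  continuous h -> continuous (omap h : adjoin -> adjoin).
Proof.
move=> /metric_continuousP ch; apply/metric_continuousP => -[x|] e e0.
  have [d d0 xd] := ch x e e0.
  exists (Num.min d 1) => [|[y|]]; rewrite /mdist/= lt_min ?d0 ?ltr01//.
    by move=> /andP[xyd _]; exact: xd.
  by move=> /andP[_]; rewrite diam1_ge1.
by exists 1 => // -[y|]; rewrite /mdist/= ?diam1_ge1.
Qed.

Definition adjoin_map : homeo adjoin :=
  @Homeo adjoin (omap (tds_map S)) (omap (homeo_inv (tds_map S)))
    (omapK (homeo_funK (tds_map S))) (omapK (homeo_invK (tds_map S)))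
    (omap_continuous (homeo_fun_continuous (h := tds_map S)))
    (omap_continuous (homeo_inv_continuous (h := tds_map S))).

End adjoin_point.

Section shift.
Variable Z : topologicalType.

Let reindex_continuous (j : int -> int) :
  continuous (fun x : {ptws int -> Z} => (x \o j : {ptws int -> Z})).
Proof.
move=> x; apply/cvg_sup; first exact/fmap_filter/nbhs_filter.
move=> i.
move: x; apply/(@continuousP _ (initial_topology (@^~ i))) => A [B oB <-].
have cj : continuous (fun x : {ptws int -> Z} => x (j i)).
  exact: (@proj_continuous int (fun=> Z) (j i)).
by move/continuousP : cj; exact.
Qed.

Let shiftK : cancel (fun x : {ptws int -> Z} => x \o (+%R^~ 1))
                    (fun x : {ptws int -> Z} => x \o (+%R^~ (- 1))).
Proof. by move=> x; apply/funext => i /=; rewrite subrK. Qed.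

Let unshiftK : cancel (fun x : {ptws int -> Z} => x \o (+%R^~ (- 1)))
                      (fun x : {ptws int -> Z} => x \o (+%R^~ 1)).
Proof. by move=> x; apply/funext => i /=; rewrite addrK. Qed.

Definition shift_homeo : homeo {ptws int -> Z} :=
  @Homeo {ptws int -> Z} (fun x i => x (i + 1)) (fun x i => x (i - 1))
    shiftK unshiftK
    (reindex_continuous (j := +%R^~ 1)) (reindex_continuous (j := +%R^~ (- 1))).

End shift.

Record scheme (R : realType) := Scheme {
  eps : nat -> R;
  len : nat -> nat;
  setA : nat -> {fset nat};
  setB : nat -> {fset nat};
  eps_nonincreasing : nonincreasing_seq eps;
  eps_bounds : forall k, 0 < eps k < 1 / 2;
  len_increasing : forall k, (len k < len k.+1)%N;
  setAB_cover : forall k,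
    (setA k `|` setB k)%fset = [fset i in iota 0 (len k)]%fset;
  setAB_disjoint : forall k, (setA k `&` setB k)%fset = fset0;
  setB_first : forall k, 0%N \in setB k;
  setB_last : forall k, (len k).-1 \in setB k;
  card_setA : forall k,
    (2 <= #|` setA k |)%N /\ #|` setA k |%:R < (len k)%:R * eps k;
  setA_return : forall k i, (i < len k)%N -> exists2 a, a \in setA k &
    (a + i)%N \in (setA k `|` [fset (len k + a')%N | a' in setA k])%fset;
  setA_shift : forall k i, (0 < i)%N -> i%:R <= (len k)%:R / 2 + 1 :> R ->
    Num.sqrt ((len k)%:R / 2) - 1 <=
      #|` ([fset (a + i)%N | a in setA k] `&` setB k)%fset |%:R :> R }.

Section construction.
Context {R : realType} (c : scheme R).

(* Indices start at -1 on paper: period k, scale k and level k stand for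
   p_(k-1), b'_(k-1) and Y_(k-1). *)
Fixpoint period (k : nat) : nat :=
  if k is j.+1 then (len c j * period j)%N else 1.

Definition cardB (k : nat) : nat := #|` setB c k |.

Fixpoint scale (k : nat) : nat :=
  if k is j.+1 then (scale j * (cardB j - 2))%N else 1.

Definition tau (k i : nat) : nat := #|` [fset j in setB c k | (j < i)%N]%fset |.

Lemma tau_increasing k : {in setB c k &, {mono tau k : i j / (i < j)%N}}.
Proof.
have homo i j : i \in setB c k -> (i < j)%N -> (tau k i < tau k j)%N.
  move=> iB ij; apply/fproper_ltn_card/andP; split.
    apply/fsubsetP => l; rewrite !inE/= => /andP[-> li]/=.
    exact: ltn_trans li ij.
  by apply/fsubsetPn; exists i; rewrite !inE/= iB ?ij ?ltnn.
move=> i j iB jB; apply/idP/idP; last exact: homo.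
apply: contraTT; rewrite -!leqNgt leq_eqVlt => /orP[/eqP->//|ji].
by rewrite ltnW// homo.
Qed.

Lemma tau_image k :
  [fset tau k i | i in setB c k]%fset = [fset i in iota 0 (cardB k)]%fset.
Proof.
apply/eqP; rewrite eqEfcard; apply/andP; split.
  apply/fsubsetP => _ /imfsetP[i /= iB ->]; rewrite !inE mem_iota add0n/=.
  apply/fproper_ltn_card/andP; split.
    by apply/fsubsetP => l; rewrite !inE/= => /andP[].
  by apply/fsubsetPn; exists i; rewrite // !inE/= iB ltnn.
rewrite card_fseq undup_id ?iota_uniq// size_iota.
rewrite card_in_imfset//.
move=> i j iB jB eqij; have [ij|ji|//] := ltngtP i j.
  by move: ij; rewrite -(tau_increasing iB jB) eqij ltnn.
by move: ji; rewrite -(tau_increasing jB iB) eqij ltnn.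
Qed.

Definition fk (k i : nat) : int :=
  if i == 0%N then 0
  else if i == (len c k).-1 then - ((cardB k)%:Z - 3)
  else (tau k i)%:Z - ((cardB k)%:Z - 2).

Variable S : tds R.

Definition sequences := {ptws int -> adjoin S}.

Definition sigma : homeo sequences := shift_homeo (adjoin S).

Definition gk (k i : nat) : adjoin S -> adjoin S :=
  homeo_pow (adjoin_map S) ((scale k)%:Z * fk k i).

Definition Qk (k : nat) : set sequences :=
  [set x | forall i, i \in setB c k -> x (i * period k)%N%:Z = gk k i (x 0)].

Definition Pk (k : nat) : set sequences :=
  [set x | forall i, i \in setA c k -> x (i * period k)%N%:Z = None].

Fixpoint level (k : nat) : set sequences :=
  if k is j.+1 then
    level j `&` \bigcap_(n in [set: int])
      (homeo_pow sigma (n * (period k)%:Z) @` (Pk j `&` Qk j))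
  else [set: sequences].

Definition Y : set sequences :=
  \bigcap_(k in [set: nat]) \bigcup_(r < period k.+1)
    (homeo_pow sigma (- r%:Z) @` level k.+1).

End construction.

(* Main.v *)
(* Up to a shift, a point of Y carries the symbol * on the blocks of length
   p_(k-1) indexed by A_k, repeated with period p_k.  Since A_k meets each of its
   translates modulo n_k, the *-blocks of two points of Y overlap in at least
   about p_(k-1)/2 consecutive coordinates, again with period p_k.  Hence, along
   arbitrarily large times in both directions, both orbits come simultaneously
   close to the fixed point (..., *, *, *, ...). *)
Require Import Defs.
From mathcomp Require Import all_boot all_order all_algebra.
From mathcomp Require Import finmap zify ring lra.
From mathcomp Require Import all_classical all_reals all_analysis.

Import Order.TTheory GRing.Theory Num.Theory.

Local Open Scope classical_set_scope.
Local Open Scope ring_scope.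

(** A basic neighbourhood in the product topology constrains finitely many coordinates, and these
    lie in some window. *)
Lemma nbhs_ptws_window (Z : topologicalType) (f : {ptws int -> Z})
    (U : set {ptws int -> Z}) : nbhs f U ->
  exists N : nat, forall w : {ptws int -> Z},
    (forall j : int, `|j| <= N%:Z -> w j = f j) -> U w.
Proof.
pose agree N : set {ptws int -> Z} :=
  [set w | forall j : int, `|j| <= N%:Z -> w j = f j].
have FF : Filter (filter_from [set: nat] agree).
  apply: filter_from_filter; first by exists 0%N.
  move=> i j _ _; exists (maxn i j) => // w wf.
  by split=> l hl; apply: wf; lia.
suff: filter_from [set: nat] agree --> f.
  by move=> cF /cF[N _ NU]; exists N => w /NU.
apply/cvg_sup => i A [_ [[B oB <-] /= Bfi] BA].
exists `|i|%N => // w wf; apply: BA => /=.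
by rewrite wf//; lia.
Qed.

Lemma compatible_metric_ge0 (R : realType) (Z : topologicalType)
    (d : Z -> Z -> R) (hd : compatible_metric d) x y : 0 <= d x y.
Proof.
case: hd => d0 dC dT _; have := dT x y x.
by rewrite (dC y x) ((d0 x x).2 erefl); lra.
Qed.

(** Both orbits come within [e / 2] of [z] at arbitrarily late times; the triangle inequality
    through [z] makes every tail infimum 0. *)
Lemma positively_proximal_common_limit (R : realType) (Z : topologicalType)
    (d : Z -> Z -> R) (hd : compatible_metric d) (h : homeo Z) (x y z : Z) :
  (forall U, nbhs z U -> forall M, exists2 n, (M <= n)%N &
    U (iter n h x) /\ U (iter n h y)) ->
  positively_proximal d h x y.
Proof.
move=> common; rewrite /positively_proximal limn_einf_lim.
set u := fun n => _.
suff -> : einfs u = cst 0%E by exact: lim_cst.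
apply/funext => M /=; apply/eqP; rewrite eq_le; apply/andP; split; last first.
  by apply: le_ereal_inf_tmp => _ [n _ <-]; rewrite lee_fin compatible_metric_ge0.
apply/lee_addgt0Pr => e e0; rewrite add0e.
have [n Mn [Ux Uy]] : exists2 n, (M <= n)%N &
    d z (iter n h x) < e / 2 /\ d z (iter n h y) < e / 2.
  apply: (common [set w | d z w < e / 2]); case: hd => _ _ _ ->.
  by exists (e / 2) => //=; lra.
apply: (@le_trans _ _ (u n)); first by apply: ereal_inf_lbound; exists n.
case: hd => _ dC dT _.
rewrite lee_fin; apply: (le_trans (dT _ z _)); rewrite (dC _ z); lra.
Qed.

Section shift_powers.
Context {R : realType} (S : tds R).

Lemma iter_sigmaE n (z : sequences S) i : iter n (sigma S) z i = z (i + n%:Z).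
Proof.
elim: n i => [|n IHn] i; first by rewrite addr0.
by rewrite iterS /= IHn -addrA; congr z; lia.
Qed.

Lemma iter_sigma_invE n (z : sequences S) i :
  iter n (homeo_inv (sigma S)) z i = z (i - n%:Z).
Proof.
elim: n i => [|n IHn] i; first by rewrite subr0.
by rewrite iterS /= IHn -addrA; congr z; lia.
Qed.

Lemma homeo_pow_sigmaE (m : int) (z : sequences S) i :
  homeo_pow (sigma S) m z i = z (i + m).
Proof. by case: m => n; [exact: iter_sigmaE|exact: iter_sigma_invE]. Qed.

Lemma homeo_pow_adjoin_None (m : int) :
  homeo_pow (adjoin_map S) m None = None.
Proof. by case: m => n /=; elim: n => //= n ->. Qed.

End shift_powers.

Section gaps.
Context {R : realType} (c : scheme R).

Lemma len_gt1 k : (1 < len c k)%N.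
Proof.
have [A2 Alen] := card_setA c k; have /andP[e0 e1] := eps_bounds c k.
have : (2%:R : R) <= #|` setA c k |%:R by rewrite ler_nat.
rewrite -(ltr_nat R) => A2R.
by have : 0 <= (len c k)%:R :> R by []; nra.
Qed.

Lemma ltn_period k : (k < period c k)%N.
Proof. by elim: k => //= k; have := len_gt1 k; nia. Qed.

Lemma mem_setAB k i : (i < len c k)%N -> (i \in setA c k) || (i \in setB c k).
Proof.
move=> ik; have : i \in [fset j in iota 0 (len c k)]%fset.
  by rewrite !inE mem_iota.
by rewrite -setAB_cover inE.
Qed.

Context {S : tds R}.
Implicit Types x y z : sequences S.

Lemma levelP k z : level c k.+1 z -> level c k z /\ forall (n : int) i,
  (i \in setA c k -> z (n * (period c k.+1)%:Z + (i * period c k)%N%:Z) = None)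
  /\ (i \in setB c k -> z (n * (period c k.+1)%:Z + (i * period c k)%N%:Z) =
        gk c k i (z (n * (period c k.+1)%:Z))).
Proof.
(* At index [- n], [w] is [z] re-centred at the coordinate [n * period c k.+1]. *)
case=> zk zPQ; split=> // n i; have [w [Pw Qw] <-] := zPQ (- n) I.
have shiftE j : homeo_pow (sigma S) (- n * (period c k.+1)%:Z) w
    (n * (period c k.+1)%:Z + j) = w j.
  by rewrite homeo_pow_sigmaE; congr w; ring.
rewrite shiftE -[X in gk _ _ _ (_ w X)]addr0 shiftE.
by split=> [/Pw|/Qw].
Qed.

(* The maps gk fix the point *, so one symbol * at a multiple of the period
   propagates to the whole block starting there. *)
Lemma level_gap k z (n : int) (j : nat) : level c k z ->
  z (n * (period c k)%:Z) = None -> (j < period c k)%N ->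
  z (n * (period c k)%:Z + j%:Z) = None.
Proof.
elim: k n j => [|k IHk] n j.
  by move=> _ zn; rewrite ltnS leqn0 => /eqP ->; rewrite addr0.
move=> /levelP[zk zAB] zn jp.
have p0 : (0 < period c k)%N by have := ltn_period k; lia.
have ilen : (j %/ period c k < len c k)%N by rewrite ltn_divLR.
(* The quotient selects the sub-block containing [j], the remainder its place there; it suffices
   that this sub-block starts with *. *)
have := IHk (n * (len c k)%:Z + (j %/ period c k)%N%:Z) (j %% period c k)%N zk.
have blockE : (n * (len c k)%:Z + (j %/ period c k)%N%:Z) * (period c k)%:Z =
    n * (period c k.+1)%:Z + (j %/ period c k * period c k)%N%:Z.
  by rewrite /= !PoszM; ring.
rewrite blockE -addrA -PoszD -divn_eq; apply; last by rewrite ltn_pmod.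
have [iA iB] := zAB n (j %/ period c k)%N.
have /orP[/iA//|/iB ->] := mem_setAB _ _ ilen.
by rewrite zn /gk homeo_pow_adjoin_None.
Qed.

Lemma Y_gap x k : Y c x -> exists r : int, forall (n : int) (a j : nat),
  a \in setA c k -> (j < period c k)%N ->
  x (r + n * (period c k.+1)%:Z + a%:Z * (period c k)%:Z + j%:Z) = None.
Proof.
move=> /(_ k I)[r _ [z zk <-]]; exists r%:Z => n a j aA jp.
rewrite homeo_pow_sigmaE.
have [zk' zAB] := levelP _ _ zk; have [za _] := zAB n a.
have blockE : n * (period c k.+1)%:Z + (a * period c k)%N%:Z =
    (n * (len c k)%:Z + a%:Z) * (period c k)%:Z.
  by rewrite /= !PoszM; ring.
rewrite -(level_gap _ _ (n * (len c k)%:Z + a%:Z) _ zk' _ jp).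
  by congr z; rewrite -blockE PoszM; ring.
by rewrite -blockE za.
Qed.

(** Condition (ii) read modulo [len c k]: [q] is 1 when [a + i] wraps around, else 0. *)
Lemma setA_return_mod k i : (i < len c k)%N -> exists (a a' : nat) (q : int),
  [/\ a \in setA c k, a' \in setA c k & a%:Z + i%:Z = a'%:Z + q * (len c k)%:Z].
Proof.
move=> /setA_return[a aA]; rewrite inE => /orP[a'A|/imfsetP[a' /= a'A aE]].
  by exists a, (a + i)%N, 0; split=> //; lia.
by exists a, a', 1; split=> //; lia.
Qed.

(* Rounding the offset of the two block structures to the nearest multiple of
   [period c k] makes some blocks of * overlap in at least about half of their
   length. *)
Lemma Y_common_gap x y N : Y c x -> Y c y ->
  exists b q : int, 0 < q /\ forall n j : int, `|j| <= N%:Z ->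
    x (b + n * q + j) = None /\ y (b + n * q + j) = None.
Proof.
(* The overlap has length at least about half of [period c k], which exceeds [k], so a window of
   radius [N] fits around its midpoint. *)
pose k := (4 * N + 8)%N.
move=> /(Y_gap x k)[r xr] /(Y_gap y k)[s ys].
have Np := ltn_period k; have L1 := len_gt1 k.
move: xr ys; rewrite /= PoszM.
set p := period c k in Np *; set L := len c k in L1 *.
move=> xr ys.
(* Adding half a period before dividing turns the floor [u] into rounding to the nearest multiple,
   with signed error [t]. *)
pose D := s - r + (p %/ 2)%N%:Z.
pose u := (D %/ p)%Z; pose t := (D %% p)%Z - (p %/ 2)%N%:Z.
have p0 : p%:Z != 0 by lia.
have L0 : L%:Z != 0 by lia.
have DE : s - r = u * p%:Z + t by have := divz_eq D p; rewrite /u /t /D; lia.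
have tge : - (p %/ 2)%N%:Z <= t by have := modz_ge0 D p0; rewrite /t; lia.
have tlt : t < p%:Z - (p %/ 2)%N%:Z.
  by have := ltz_mod D p0; rewrite /t; lia.
pose i := `|(u %% L)%Z|%N.
have iE : i%:Z = (u %% L)%Z by rewrite /i; have := modz_ge0 u L0; lia.
have iL : (i < L)%N by have := ltz_mod u L0; lia.
have uE : u = (u %/ L)%Z * L%:Z + i%:Z by rewrite iE -divz_eq.
have [a [a' [q [aA a'A aE]]]] := setA_return_mod _ _ iL.
(* Midpoint of the overlap of the intervals [[0, p)] and [[t, t + p)], whatever the sign of [t]. *)
pose h := ((p%:Z + t) %/ 2)%Z.
have [h1 h2] : h * 2 <= p%:Z + t /\ p%:Z + t <= h * 2 + 1 by rewrite /h; lia.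
exists (r + a'%:Z * p%:Z + h), (L%:Z * p%:Z); split; first by nia.
move=> n j jN; split.
  rewrite -(xr n a' `|(h + j)%R|%N a'A); last by move: Np; rewrite /k; lia.
  have -> : (`|(h + j)%R|%N : int) = h + j by move: Np; rewrite /k; lia.
  by congr x; ring.
(* The period index absorbs the wrap-around [q] and the full periods contained in [u]. *)
rewrite -(ys (n - q - (u %/ L)%Z) a `|(h + j - t)%R|%N aA); last first.
  by move: Np; rewrite /k; lia.
have -> : (`|(h + j - t)%R|%N : int) = h + j - t by move: Np; rewrite /k; lia.
have sE : s = r + u * p%:Z + t by move: DE; lia.
congr y; rewrite sE [in u * _]uE.
have -> : a%:Z = a'%:Z + q * L%:Z - i%:Z by move: aE; lia.
ring.
Qed.

End gaps.

Theorem proposition3p5 (R : realType) (S : tds R) (c : scheme R)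
    (d : sequences S -> sequences S -> R) (hd : compatible_metric d)
    (x y : sequences S) (hx : Y c x) (hy : Y c y) :
  positively_proximal d (sigma S) x y /\ negatively_proximal d (sigma S) x y.
Proof.
rewrite /negatively_proximal.
split; apply: (positively_proximal_common_limit _ _ d hd _ x y (fun=> None))
  => U /nbhs_ptws_window[N NU] M;
  have [b [q [q0 gap]]] := Y_common_gap c x y N hx hy.
(* Since [q] is at least 1, [M + |b|] periods bring the common gap to a coordinate at least [M]. *)
- exists `|(b + (M%:Z + `|b|) * q)%R|%N; first by nia.
  have nE : (`|(b + (M%:Z + `|b|) * q)%R|%N : int) = b + (M%:Z + `|b|) * q by nia.
  split; apply: NU => j /(gap (M%:Z + `|b|))[gx gy];
    by rewrite iter_sigmaE nE addrC.
(* Symmetrically, the gap now sits at a coordinate at most [- M], reached by the inverse shift. *)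
- exists `|(b - (M%:Z + `|b|) * q)%R|%N; first by nia.
  have nE : - (`|(b - (M%:Z + `|b|) * q)%R|%N : int) = b + - (M%:Z + `|b|) * q.
    by nia.
  split; apply: NU => j /(gap (- (M%:Z + `|b|)))[gx gy];
    by rewrite iter_sigma_invE nE addrC.
Qed.
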